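(* Let $n>1$ be an integer, and suppose the global array $d$ satisfies $d_j=1$ for all $j>1$. Then the call $\mathrm{RecDesc}(2n,n,1)$ results in exactly $p(n)+p(n-1)$ invocations of $\mathrm{RecDesc}$ in total, counting the initial call and all recursive calls.
   Context: $p(n)$ denotes the number of partitions of $n$. The recursive procedure $\mathrm{RecDesc}(n,m,k)$, with preconditions $1\le m\le n$ and $d_j=1$ for all $j>k$, operates on a global array $d$ as follows: 1. $d_k\leftarrow m$. 2. If $n=m$ or $m=1$, visit $\langle d_1,\dots,d_{k+n-m}\rangle$. 3. Otherwise: for $x=1$ to $\min(m,n-m)$, call $\mathrm{RecDesc}(n-m,x,k+1)$; then set $d_k\leftarrow 1$. The call $\mathrm{RecDesc}(2n,n,1)$ generates all descending compositions of $2n$ with first part $n$. Omitting $d_1$ from each visited sequence therefore generates all descending compositions of $n$. *)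

(* Defs.v *)
From mathcomp Require Import all_boot.

Set Implicit Arguments.
Unset Strict Implicit.
Unset Printing Implicit Defensive.

Definition is_partition (n : nat) (s : seq nat) : bool :=
  [&& sorted geq s, all (leq 1) s & sumn s == n].

Lemma is_partition_bounds n s :
  is_partition n s -> size s <= n /\ all (fun x => x <= n) s.
Proof.
case/and3P=> _ s_gt0 /eqP <-; elim: s s_gt0 => //= x s IHs /andP[x_gt0].
case/IHs=> size_s le_s; split; first by rewrite -add1n leq_add.
rewrite leq_addr; apply: sub_all le_s => y le_y.
exact: leq_trans le_y (leq_addl _ _).
Qed.

(* By [is_partition_bounds], the bounds in the type of [s] exclude no
   partition of n: they only make the type finite. *)
Definition npartitions (n : nat) : nat :=
  #|[set s : n.-bseq 'I_n.+1 | is_partition n (map val s)]|.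

(* The global array, indexed from 1; the entry at 0 is never accessed. *)
Definition array : Type := nat -> nat.

Definition update (d : array) (k v : nat) : array :=
  fun j => if j == k then v else d j.

Definition prefix_of (d : array) (l : nat) : seq nat :=
  [seq d j | j <- iota 1 l].

(* Big-step semantics.  [RecDesc n m k d d' vs c]: the call RecDesc(n, m, k),
   started with global array d, terminates with global array d', after visiting
   the sequences vs in that order, and takes c invocations of RecDesc in all,
   itself included.  [RecDesc_for n m k x d d' vs c] is the same for the
   iterations x, x + 1, ..., min(m, n - m) of the loop in the body of that call.
   The truncated subtraction is harmless under the precondition 1 <= m <= n,
   which all recursive calls inherit.  Preconditions are not guards of the
   semantics; the array never influences the flow of control.  Only the branch
   with the loop resets entry k to 1. *)
Inductive RecDesc :
    nat -> nat -> nat -> array -> array -> seq (seq nat) -> nat -> Prop :=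
| RecDesc_visit n m k d :
    n = m \/ m = 1 ->
    RecDesc n m k d (update d k m) [:: prefix_of (update d k m) (k + n - m)] 1
| RecDesc_rec n m k d d' vs c :
    ~ (n = m \/ m = 1) ->
    RecDesc_for n m k 1 (update d k m) d' vs c ->
    RecDesc n m k d (update d' k 1) vs c.+1
with RecDesc_for :
    nat -> nat -> nat -> nat -> array -> array -> seq (seq nat) -> nat -> Prop :=
| RecDesc_for_end n m k x d :
    minn m (n - m) < x ->
    RecDesc_for n m k x d d [::] 0
| RecDesc_for_step n m k x d d1 d2 vs1 vs2 c1 c2 :
    x <= minn m (n - m) ->
    RecDesc (n - m) x k.+1 d d1 vs1 c1 ->
    RecDesc_for n m k x.+1 d1 d2 vs2 c2 ->
    RecDesc_for n m k x d d2 (vs1 ++ vs2) (c1 + c2).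

(* Main.v *)
Require Import Defs.
From mathcomp Require Import all_boot zify.

(** A call RecDesc(n, m, k) is a leaf of the call tree when n = m or m = 1, and
leaves correspond to the partitions of n with largest part m.  An inner call is
determined by its prefix d_1, ..., d_k, whose last part exceeds 1 and which
leaves a positive remainder; filling up with ones maps inner calls bijectively
to the partitions of n with largest part m that contain a 1, that is, to the
partitions of n - 1 with largest part m.  So if q(N, M) is the number of
partitions of N into parts at most M, the call takes q(n - m, m) + q(n - m - 1, m)
invocations when 1 < m < n.  The count also satisfies the recursion of the
procedure, by the recurrence
q(N, M) = sum_(1 <= x <= min(M, N)) q(N - x, x). *)

(* Complete only if the fuel [f] is at least [N]. *)
Fixpoint bounded_partitions (f N M : nat) : seq (seq nat) :=
  if f is f'.+1 then
    if N == 0 then [:: [::]] else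
    [seq x :: s | x <- iota 1 (minn M N), s <- bounded_partitions f' (N - x) x]
  else [:: [::]].

Definition num_bounded_partitions (N M : nat) : nat :=
  size (bounded_partitions N N M).

Lemma bounded_partitions_fuel f N M :
  N <= f -> bounded_partitions f N M = bounded_partitions N N M.
Proof.
(* Two independent fuels keep the claim inductive: one unfolding leaves unequal fuels on the two
   sides. *)
suff eq_fuel g h K L : K <= g -> K <= h ->
    bounded_partitions g K L = bounded_partitions h K L.
  by move=> le_Nf; apply: eq_fuel.
elim: g h K L => [|g IHg] [|h] [|K] L //= le_Kg le_Kh.
congr flatten; apply/eq_in_map => x; rewrite mem_iota => /andP[x_gt0 _].
by congr map; apply: IHg; lia.
Qed.

Lemma num_bounded_partitions_rec N M : 0 < N ->
  num_bounded_partitions N M =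
  \sum_(1 <= x < (minn M N).+1) num_bounded_partitions (N - x) x.
Proof.
case: N => // N _; rewrite {1}/num_bounded_partitions /=.
rewrite size_allpairs_dep sumnE big_map /index_iota subn1.
rewrite big_seq_cond [RHS]big_seq_cond; apply: eq_bigr => x.
rewrite mem_iota => /andP[/andP[x_gt0 _] _].
by rewrite bounded_partitions_fuel //; lia.
Qed.

Lemma num_bounded_partitions0 M : num_bounded_partitions 0 M = 1.
Proof. by []. Qed.

Lemma num_bounded_partitions1r N : num_bounded_partitions N 1 = 1.
Proof.
elim: N => [|N IHN] //; rewrite num_bounded_partitions_rec //.
by rewrite (_ : minn 1 N.+1 = 1) ?big_nat1 ?subn1 //; lia.
Qed.

(** In a descending sequence the head [x] bounds the tail, so the tail is a partition of [N - x]
    into parts at most [x]. *)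
Lemma mem_bounded_partitions f N M s : N <= f ->
  (s \in bounded_partitions f N M) = is_partition N s && all (geq M) s.
Proof.
have partition0 t : is_partition 0 t = (t == [::]).
  by rewrite /is_partition; case: t => [|[|x] t] //=; rewrite ?andbF.
elim: f N M s => [|f IHf] [|N] M s //= le_Nf;
  try by rewrite inE partition0; case: s.
apply/allpairsPdep/idP => [[x [t [x_in t_in ->]]] | ].
  move: x_in t_in; rewrite mem_iota => x_bd; rewrite IHf; last lia.
  rewrite /is_partition => /andP[/and3P[t_sorted t_pos /eqP t_sum] t_le].
  rewrite /= path_sortedE; last exact: rev_trans leq_trans.
  rewrite t_le t_sorted t_pos t_sum /=.
  apply/andP; split; first by apply/andP; split; lia.
  apply/andP; split; first by rewrite /geq /=; lia.
  by apply: sub_all t_le => y; rewrite /geq /=; lia.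
rewrite /is_partition; case: s => [|x t] //.
rewrite /= path_sortedE; last exact: rev_trans leq_trans.
case/andP=> /and3P[/andP[t_le t_sorted] /andP[x_gt0 t_pos] /eqP t_sum].
case/andP=> x_le _; exists x, t; split=> //.
  by rewrite mem_iota; move: x_le; rewrite /geq /=; lia.
rewrite IHf; last lia.
by rewrite /is_partition t_sorted t_pos t_le !andbT /=; apply/eqP; lia.
Qed.

Lemma bounded_partitions_uniq f N M : uniq (bounded_partitions f N M).
Proof.
elim: f N M => [|f IHf] [|N] M //.
apply: allpairs_uniq_dep => [|x _|]; [exact: iota_uniq | exact: IHf |].
by move=> [x s] [y t] _ _ /= [-> ->].
Qed.

(** Parts of a partition of [n] never exceed [n], so both sides are sizes of duplicate-free lists
    with the same members. *)
Lemma npartitionsE n M : n <= M -> npartitions n = num_bounded_partitions n M.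
Proof.
move=> le_nM; pose values (s : n.-bseq 'I_n.+1) := map val s.
have values_inj : injective values.
  by move=> s t /(inj_map val_inj) /val_inj.
rewrite /npartitions cardE -(size_map values); apply/perm_size/uniq_perm.
- by rewrite map_inj_uniq ?enum_uniq.
- exact: bounded_partitions_uniq.
move=> s; rewrite mem_bounded_partitions //.
apply/mapP/andP => [[t] | [s_part _]].
  rewrite mem_enum inE => t_part ->; split=> //.
  apply: sub_all (proj2 (is_partition_bounds t_part)) => x.
  by rewrite /geq /=; lia.
have [size_s le_s] := is_partition_bounds s_part.
have inordK_s : map val (map (@inord n) s) = s.
  rewrite -map_comp map_id_in // => x x_s.
  by rewrite /= inordK // ltnS (allP le_s).
have size_inord : size (map (@inord n) s) <= n by rewrite size_map.
by exists (Bseq size_inord); rewrite /values ?mem_enum ?inE /= inordK_s.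
Qed.

(** Leaves plus inner calls; the guard is needed since a leaf call has no inner calls, while
    [(n - m).-1] truncates to 0 at [n = m]. *)
Definition num_calls (n m : nat) : nat :=
  num_bounded_partitions (n - m) m +
  (if 1 < m < n then num_bounded_partitions (n - m).-1 m else 0).

Lemma num_calls_leaf n m : n = m \/ m = 1 -> num_calls n m = 1.
Proof.
rewrite /num_calls => -[<- | ->]; first by rewrite subnn ltnn andbF.
by rewrite num_bounded_partitions1r.
Qed.

Lemma num_calls_rec n m : 1 < m < n ->
  num_calls n m = (\sum_(1 <= x < (minn m (n - m)).+1) num_calls (n - m) x).+1.
Proof.
move=> m_bd; rewrite /num_calls m_bd big_split /=.
rewrite -num_bounded_partitions_rec ?subn_gt0; last by case/andP: m_bd.
rewrite -addnS; congr addn; have : 0 < n - m by lia.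
move: (n - m) => [|[|N]] // _.
  by rewrite (_ : minn m 1 = 1) ?big_nat1 //; lia.
(* The call with x = 1 is a leaf and adds nothing here; the missing summand
   q(N, 1) = 1 of the recurrence accounts for the root call. *)
rewrite [in RHS]big_ltn /=; last lia.
rewrite num_bounded_partitions_rec // big_ltn; last lia.
rewrite num_bounded_partitions1r add1n add0n; congr _.+1.
have [le_mN | lt_Nm] := leqP m N.+1.
  rewrite (minn_idPl (leqW le_mN)).
  apply: eq_big_nat => x x_bd; rewrite ifT; last lia.
  by congr num_bounded_partitions; lia.
rewrite (minn_idPr lt_Nm).
(* The surplus index [x = N.+2] equals the remainder: that call is a leaf and adds 0. *)
rewrite [RHS]big_nat_recr //= ltnn addn0.
apply: eq_big_nat => x x_bd; rewrite ifT; last lia.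
by congr num_bounded_partitions; lia.
Qed.

Scheme RecDesc_mut_ind := Minimality for RecDesc Sort Prop
  with RecDesc_for_mut_ind := Minimality for RecDesc_for Sort Prop.

(** By mutual induction on derivations: the loop from [x] on accounts for a tail of the sum in
    [num_calls_rec]. *)
Lemma RecDesc_num_calls n m k d d' vs c :
  RecDesc n m k d d' vs c -> 0 < m <= n -> c = num_calls n m.
Proof.
pose calls_eq n m (_ : nat) (_ _ : array) (_ : seq (seq nat)) c :=
  0 < m <= n -> c = num_calls n m.
pose loop_calls_eq n m (_ : nat) x (_ _ : array) (_ : seq (seq nat)) c :=
  0 < m < n -> 0 < x ->
  c = \sum_(x <= i < (minn m (n - m)).+1) num_calls (n - m) i.
move: n m k d d' vs c.
apply: (@RecDesc_mut_ind calls_eq loop_calls_eq); rewrite /calls_eq /loop_calls_eq.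
- by move=> n m _ _ leaf _; rewrite num_calls_leaf.
- move=> n m _ _ _ _ c not_leaf _ IHloop m_bd.
  by rewrite num_calls_rec ?IHloop //; lia.
- by move=> n m _ x _ x_gt _ _; rewrite big_geq.
move=> n m _ x _ _ _ _ _ c1 c2 x_le _ IHcall _ IHloop m_bd x_gt0.
by rewrite big_ltn // -IHcall -?IHloop //; lia.
Qed.

Lemma RecDesc_terminates n m k d : 0 < m <= n ->
  exists (d' : array) (vs : seq (seq nat)), RecDesc n m k d d' vs (num_calls n m).
Proof.
elim/ltn_ind: n m k d => n IHn m k d m_bd.
have [leaf | not_leaf] : (n = m \/ m = 1) \/ ~ (n = m \/ m = 1) by lia.
  by rewrite num_calls_leaf //; do 2 eexists; apply: RecDesc_visit.
(* Here [j] bounds the number of iterations left, and [e] is arbitrary because each subcall alters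
   the array. *)
have loop j x e : minn m (n - m) < x + j -> 0 < x ->
    exists (d' : array) (vs : seq (seq nat)), RecDesc_for n m k x e d' vs
      (\sum_(x <= i < (minn m (n - m)).+1) num_calls (n - m) i).
  elim: j x e => [|j IHj] x e x_bd x_gt0.
    rewrite big_geq; last lia.
    by exists e, [::]; apply: RecDesc_for_end; lia.
  have [x_le | x_gt] := leqP x (minn m (n - m)); last first.
    by rewrite big_geq //; exists e, [::]; apply: RecDesc_for_end.
  have [|| e1 [vs1 call]] := IHn (n - m) _ x k.+1 e; try lia.
  have [|| e2 [vs2 calls]] := IHj x.+1 e1; try lia.
  rewrite big_ltn //; exists e2, (vs1 ++ vs2).
  exact: RecDesc_for_step call calls.
have [|| d' [vs calls]] := loop (minn m (n - m)) 1 (update d k m); try lia.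
exists (update d' k 1), vs; rewrite num_calls_rec; last lia.
exact: RecDesc_rec.
Qed.

Theorem theorem2p3 (n : nat) (d : array) (n_gt1 : 1 < n)
    (d_eq1 : forall j : nat, 1 < j -> d j = 1) :
  forall c : nat,
    (exists (d' : array) (vs : seq (seq nat)), RecDesc (2 * n) n 1 d d' vs c)
    <-> c = npartitions n + npartitions (n - 1).
Proof.
(* The bound [n] on the parts is no restriction for partitions of [n] and of [n - 1]. *)
have num_callsE : num_calls (2 * n) n = npartitions n + npartitions (n - 1).
  rewrite /num_calls ifT; last lia.
  rewrite (@npartitionsE n n) // (@npartitionsE _ n) ?leq_subr //.
  by congr addn; congr num_bounded_partitions; lia.
move=> c; rewrite -num_callsE; split=> [[d' [vs run]] | ->].
  by apply: RecDesc_num_calls run _; lia.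
by apply: RecDesc_terminates; lia.
Qed.
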